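(* There exists a unital C*-algebra $A$ which is infinite, and which contains a dense, unital $*$-subalgebra $A_0$ (i.e. $A_0$ contains the unit of $A$ and is norm-dense in $A$) that is stably finite.
   Context: A unital algebra $B$ is finite if every left invertible element of $B$ is right invertible (i.e. $xy=1$ implies $yx=1$ for $x,y\in B$), and infinite otherwise. A unital algebra $B$ is stably finite if the matrix algebra $M_n(B)$ is finite for every $n\in\mathbb{N}$. *)

(* Defs.v *)
From HB Require Import structures.
From mathcomp Require Import all_boot all_order all_algebra.
From mathcomp Require Import reals.
From mathcomp.real_closed Require Import complex.
Set Implicit Arguments. Unset Strict Implicit. Unset Printing Implicit Defensive.
Import Order.TTheory GRing.Theory Num.Theory.
Local Open Scope ring_scope.

Definition finite_ring (B : pzRingType) : Prop :=
  forall x y : B, x * y = 1 -> y * x = 1.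

Record is_cstar_algebra (R : realType) (A : algType R[i])
    (star : A -> A) (nrm : A -> R) : Prop := {
  cs_nrm_eq0 : forall x, nrm x = 0 <-> x = 0;
  cs_nrm_triangle : forall x y, nrm (x + y) <= nrm x + nrm y;
  cs_nrm_scale : forall (c : R[i]) x,
      real_complex R (nrm (c *: x)) = `|c| * real_complex R (nrm x);
  cs_nrm_submul : forall x y, nrm (x * y) <= nrm x * nrm y;
  cs_complete : forall u : nat -> A,
      (forall e : R, 0 < e -> exists N, forall m n : nat,
          (N <= m)%N -> (N <= n)%N -> nrm (u m - u n) < e) ->
      exists l : A, forall e : R, 0 < e -> exists N, forall n : nat,
          (N <= n)%N -> nrm (u n - l) < e;
  cs_star_invol : forall x, star (star x) = x;
  cs_star_add : forall x y, star (x + y) = star x + star y;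
  cs_star_scale : forall (c : R[i]) x, star (c *: x) = Num.conj c *: star x;
  cs_star_mul : forall x y, star (x * y) = star y * star x;
  cs_cstar_id : forall x, nrm (star x * x) = nrm x ^+ 2
}.

Definition unital_star_subalgebra (R : realType) (A : algType R[i])
    (star : A -> A) (A0 : A -> Prop) : Prop :=
  [/\ A0 1,
      (forall x y, A0 x -> A0 y -> A0 (x + y)),
      (forall (c : R[i]) x, A0 x -> A0 (c *: x)),
      (forall x y, A0 x -> A0 y -> A0 (x * y)) &
      (forall x, A0 x -> A0 (star x))].

Definition norm_dense (R : realType) (A : algType R[i]) (nrm : A -> R)
    (A0 : A -> Prop) : Prop :=
  forall (x : A) (e : R), 0 < e -> exists y, A0 y /\ nrm (x - y) < e.

Definition stably_finite_sub (A : pzRingType) (A0 : A -> Prop) : Prop :=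
  forall (n : nat) (X Y : 'M[A]_n),
    (forall i j, A0 (X i j)) -> (forall i j, A0 (Y i j)) ->
    X *m Y = 1%:M -> Y *m X = 1%:M.

(* Main.v *)
Require Import Defs.
From HB Require Import structures.
From mathcomp Require Import all_boot all_order all_algebra.
From mathcomp Require Import boolp classical_sets functions reals.
From mathcomp Require Import topology normedtype sequences.
From mathcomp.real_closed Require Import complex.
From mathcomp Require Import ring lra zify.
Set Implicit Arguments. Unset Strict Implicit. Unset Printing Implicit Defensive.
Import Order.TTheory GRing.Theory Num.Theory.
Import numFieldNormedType.Exports.
Local Open Scope ring_scope.

(** Work on countably many copies of l^2, numbered by j, with a parameter taking the
    value 2^-j on the j-th copy (so it is 1 on the copy j = 0).  Let A0 consist of the
    block diagonal operators whose (k, l) matrix entries are polynomials p_kl in the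
    parameter, with p_kl = 0 off a band, such that for j >= 1 the j-th block has no
    off-diagonal entry beyond row and column j.  If X Y = 1 over A0, then every block
    j >= 1 of Y X - 1 vanishes, because it is a matter of finite matrices over the
    complex numbers; hence the polynomials giving the entries of Y X - 1 vanish at all
    2^-j, j >= 1, so they are zero and Y X = 1, on the copy j = 0 as well.  On the other
    hand A0 contains the parameter h and a weighted shift a that is the unilateral shift
    on the copy j = 0, and h^m (a - 1) + 1 tends in norm to the non-unitary isometry
    which is the shift on the copy j = 0 and the identity on the others. *)

(** * The real inner product on the complex numbers *)

Section ComplexDot.
Variable R : realType.
Implicit Types a b c : R[i].

(** This is the real part of [a * conjc b]; with real values, series and inequalities stay in
    [R]. *)
Definition cdot a b : R := complex.Re a * complex.Re b + complex.Im a * complex.Im b.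

Lemma cdotC a b : cdot a b = cdot b a.
Proof. by rewrite /cdot; case: a b => [x y] [x' y'] /=; ring. Qed.

Lemma cdotr1 a : cdot a 1 = complex.Re a.
Proof. by rewrite /cdot /= mulr1 mulr0 addr0. Qed.

Lemma cdotr0 a : cdot a 0 = 0.
Proof. by rewrite /cdot /= !mulr0 addr0. Qed.

Lemma cdotDl a b c : cdot (a + b) c = cdot a c + cdot b c.
Proof. by rewrite /cdot; case: a b c => [x y] [x' y'] [x'' y''] /=; ring. Qed.

Lemma cdotZ a b c : cdot (c * a) b = cdot a (conjc c * b).
Proof. by rewrite /cdot; case: a b c => [x y] [x' y'] [x'' y''] /=; ring. Qed.

Lemma cdot_realZ (t : R) a b : cdot (real_complex R t * a) b = t * cdot a b.
Proof. by rewrite /cdot; case: a b => [x y] [x' y'] /=; ring. Qed.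

Lemma cdot_ge0 a : 0 <= cdot a a.
Proof. by rewrite addr_ge0 // -expr2 sqr_ge0. Qed.

Lemma cdot_eq0 a : cdot a a = 0 -> a = 0.
Proof.
move=> /eqP; rewrite /cdot -!expr2 paddr_eq0 ?sqr_ge0 // !sqrf_eq0.
by case: a => [x y] /= /andP[/eqP-> /eqP->].
Qed.

Lemma cdot_add_le a b : cdot (a + b) (a + b) <= 2 * (cdot a a + cdot b b).
Proof.
rewrite /cdot; case: a b => [x y] [x' y'] /=.
by have := sqr_ge0 (x - x'); have := sqr_ge0 (y - y'); nra.
Qed.

(** A crude Cauchy-Schwarz inequality, used to dominate the series of an inner product by the two
    series of squares. *)
Lemma cdot_le a b : `|cdot a b| <= cdot a a + cdot b b.
Proof.
rewrite /cdot; case: a b => [x y] [x' y'] /=.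
have := sqr_ge0 (x - x'); have := sqr_ge0 (y - y').
have := sqr_ge0 (x + x'); have := sqr_ge0 (y + y').
have := sqr_ge0 x; have := sqr_ge0 x'; have := sqr_ge0 y; have := sqr_ge0 y'.
by move=> *; rewrite ler_norml; apply/andP; split; nra.
Qed.

Lemma cdotMM a b : cdot (a * b) (a * b) = cdot a a * cdot b b.
Proof. by rewrite /cdot; case: a b => [x y] [x' y'] /=; ring. Qed.

Lemma normC_cdot a : `|a| = real_complex R (Num.sqrt (cdot a a)).
Proof. by rewrite normc_def /cdot !expr2. Qed.

End ComplexDot.

(** * The vector space of square-summable complex sequences *)

Section SquareSummable.
Variable R : realType.
Implicit Types (u v : nat -> R[i]).

Definition sqsum u n : R := \sum_(k < n) cdot (u k) (u k).

Definition square_summable u := exists M, forall n, sqsum u n <= M.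

Definition l2_pred : {pred nat -> R[i]} := fun u => `[< square_summable u >].

Lemma l2_submod : submod_closed l2_pred.
Proof.
split=> [|c u v /asboolP[M Mu] /asboolP[N Nv]]; apply/asboolP.
  by exists 0 => n; rewrite /sqsum big1 // => k _; rewrite /cdot /= !mul0r addr0.
exists (2 * (cdot c c * M + N)) => n.
apply: (@le_trans _ _ (2 * (cdot c c * sqsum u n + sqsum v n))); last first.
  by rewrite ler_pM2l // lerD // ler_wpM2l // cdot_ge0.
rewrite /sqsum mulr_sumr -big_split /= mulr_sumr ler_sum // => k _.
by apply: le_trans (cdot_add_le _ _) _; rewrite cdotMM.
Qed.

HB.instance Definition _ := GRing.isSubmodClosed.Build R[i] (nat -> R[i]) l2_pred l2_submod.

Record l2 := L2 { l2_val :> nat -> R[i]; _ : l2_val \in l2_pred }.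
HB.instance Definition _ := [isSub for l2_val].
HB.instance Definition _ := [Choice of l2 by <:].
HB.instance Definition _ := [SubChoice_isSubLmodule of l2 by <:].

End SquareSummable.

(** * Hilbert spaces over the complex numbers *)

Record hilbert (R : realType) := Hilbert {
  hcarrier :> lmodType R[i];
  (* The real part of the complex inner product; [hdotZ] makes it determine the latter. *)
  hdot : hcarrier -> hcarrier -> R;
  hdotC : forall u v, hdot u v = hdot v u;
  hdotDl : forall u v w, hdot (u + v) w = hdot u w + hdot v w;
  hdot_realZ : forall (t : R) u v, hdot (real_complex R t *: u) v = t * hdot u v;
  hdotZ : forall (c : R[i]) u v, hdot (c *: u) v = hdot u (conjc c *: v);
  hdot_ge0 : forall u, 0 <= hdot u u;
  hdot_eq0 : forall u, hdot u u = 0 -> u = 0;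
  hdot_complete : forall u : nat -> hcarrier,
    (forall e : R, 0 < e -> exists N, forall m n, (N <= m)%N -> (N <= n)%N ->
       hdot (u m - u n) (u m - u n) < e) ->
    exists l, forall e : R, 0 < e -> exists N, forall n, (N <= n)%N ->
       hdot (u n - l) (u n - l) < e;
  hilbert_nontrivial : exists u : hcarrier, u != 0
}.

(** * Square-summable sequences form a Hilbert space *)

Section L2Hilbert.
Local Open Scope classical_set_scope.
Variable R : realType.
Implicit Types (u v w : l2 R).

Definition l2_dot u v : R := limn (series (fun k => cdot (u k) (v k))).

Lemma sqsumE u n : sqsum u n = series (fun k => cdot (u k) (u k)) n.
Proof. by rewrite /sqsum /series /= big_mkord. Qed.

Lemma sqsum_nondecreasing u : nondecreasing_seq (series (fun k => cdot (u k) (u k))).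
Proof. by apply: nondecreasing_series => k _ _; exact: cdot_ge0. Qed.

Lemma cvg_l2_sq u : cvgn (series (fun k => cdot (u k) (u k))).
Proof.
apply: nondecreasing_is_cvgn; first exact: sqsum_nondecreasing.
have /asboolP[M uM] := valP u.
by exists M => _ [n _ <-]; rewrite -sqsumE.
Qed.

Lemma cvg_l2_dot u v : cvgn (series (fun k => cdot (u k) (v k))).
Proof.
apply: normed_cvg.
apply: (@series_le_cvg _ _ (fun k => cdot (u k) (u k) + cdot (v k) (v k))).
- by move=> n; exact: normr_ge0.
- by move=> n; rewrite addr_ge0 ?cdot_ge0.
- by move=> n; exact: cdot_le.
rewrite [X in cvgn X](_ : _ = series (fun k => cdot (u k) (u k)) \+
   series (fun k => cdot (v k) (v k))).
  by apply: is_cvgD; exact: cvg_l2_sq.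
by apply/funext => n; rewrite /series /= -big_split.
Qed.

Lemma l2_dotC u v : l2_dot u v = l2_dot v u.
Proof.
by rewrite /l2_dot; congr (limn (series _)); apply/funext => k; exact: cdotC.
Qed.

Lemma l2_dotDl u v w : l2_dot (u + v) w = l2_dot u w + l2_dot v w.
Proof.
rewrite /l2_dot -limD; [|exact: cvg_l2_dot..]; congr (limn _).
apply/funext => n; rewrite fctE /series /= -big_split /=.
by apply: eq_bigr => k _; rewrite -cdotDl.
Qed.

Lemma l2_dot_realZ (t : R) u v : l2_dot (real_complex R t *: u) v = t * l2_dot u v.
Proof.
rewrite /l2_dot -[RHS]/(t *: _) -limZl_tmp; last exact: cvg_l2_dot.
congr (limn _).
apply/funext => n; rewrite fctE /series /= scaler_sumr.
by apply: eq_bigr => k _; exact: cdot_realZ.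
Qed.

Lemma l2_dotZ (c : R[i]) u v : l2_dot (c *: u) v = l2_dot u (conjc c *: v).
Proof.
by rewrite /l2_dot; congr (limn (series _)); apply/funext => k; exact: cdotZ.
Qed.

Lemma sqsum_le_l2_dot u n : sqsum u n <= l2_dot u u.
Proof.
rewrite sqsumE; apply: nondecreasing_cvgn_le; last exact: cvg_l2_sq.
exact: sqsum_nondecreasing.
Qed.

Lemma l2_dot_le u (M : R) : (forall n, sqsum u n <= M) -> l2_dot u u <= M.
Proof.
move=> uM; apply: limr_le; first exact: cvg_l2_sq.
by apply: nearW => n; rewrite -sqsumE.
Qed.

Lemma l2_dot_ge0 u : 0 <= l2_dot u u.
Proof. by apply: le_trans (sqsum_le_l2_dot u 0); rewrite /sqsum big_ord0. Qed.

Lemma cdot_le_l2_dot u k : cdot (u k) (u k) <= l2_dot u u.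
Proof.
apply: le_trans (sqsum_le_l2_dot u k.+1); rewrite /sqsum big_ord_recr /= lerDr.
by rewrite sumr_ge0 // => i _; exact: cdot_ge0.
Qed.

Lemma l2_ext u v : (forall k, u k = v k) -> u = v.
Proof. by move=> uv; apply: val_inj; apply/funext. Qed.

Lemma l2_subE u v k : (u - v) k = u k - v k. Proof. by []. Qed.

Lemma l2_dot_eq0 u : l2_dot u u = 0 -> u = 0.
Proof.
move=> u0; apply: l2_ext => k; apply: cdot_eq0; apply/eqP.
by rewrite eq_le cdot_ge0 -u0 cdot_le_l2_dot.
Qed.

(** Phrased with squares because the coordinates of an l^2 Cauchy sequence are controlled through
    [cdot], a sum of two squares. *)
Lemma real_cauchy_cvg (x : nat -> R) :
  (forall e, 0 < e -> exists N, forall m n, (N <= m)%N -> (N <= n)%N ->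
     (x m - x n) ^+ 2 < e) ->
  exists l : R, x @ \oo --> l.
Proof.
move=> xC; suff xl : cvgn x by exists (limn x).
apply/cauchy_cvgP; apply: cauchy_exP => e e0.
have [N xN] := xC (e ^+ 2) (exprn_gt0 _ e0).
exists (x N), N => // n /= Nn; rewrite /ball /=.
have := xN N n (leqnn N) Nn; rewrite -(real_normK (num_real _)) ltr_sqr ?nnegrE //.
exact: ltW.
Qed.

Lemma l2_dot_complete (u : nat -> l2 R) :
  (forall e : R, 0 < e -> exists N, forall m n, (N <= m)%N -> (N <= n)%N ->
     l2_dot (u m - u n) (u m - u n) < e) ->
  exists l, forall e : R, 0 < e -> exists N, forall n, (N <= n)%N ->
     l2_dot (u n - l) (u n - l) < e.
Proof.
move=> uC.
have cR k : exists a : R, (fun n => complex.Re (u n k)) @ \oo --> a.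
  apply: real_cauchy_cvg => e /uC[N uN]; exists N => m n Nm Nn.
  apply: le_lt_trans (uN m n Nm Nn); apply: le_trans (cdot_le_l2_dot _ k).
  by rewrite l2_subE /cdot !raddfB /= -!expr2 lerDl sqr_ge0.
have cI k : exists b : R, (fun n => complex.Im (u n k)) @ \oo --> b.
  apply: real_cauchy_cvg => e /uC[N uN]; exists N => m n Nm Nn.
  apply: le_lt_trans (uN m n Nm Nn); apply: le_trans (cdot_le_l2_dot _ k).
  by rewrite l2_subE /cdot !raddfB /= -!expr2 lerDr sqr_ge0.
pose l k : R[i] := Complex (projT1 (cid (cR k))) (projT1 (cid (cI k))).
(* Truncated at [K] terms, the squared distance is a finite sum, so coordinatewise convergence
   suffices for the limit in [m]. *)
have ul n K : (fun m => sqsum (u n - u m) K) @ \oo --> sqsum (fun k => u n k - l k) K.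
  rewrite /sqsum; elim: K => [|K IH].
    by under eq_fun do rewrite big_ord0; rewrite big_ord0; exact: cvg_cst.
  under eq_fun do rewrite big_ord_recr; rewrite big_ord_recr /=.
  apply: cvgD => //; rewrite /cdot /=.
  have hR : (fun m => complex.Re (u n K - u m K)) @ \oo --> complex.Re (u n K - l K).
    rewrite raddfB /=; under eq_fun do rewrite raddfB /=.
    by apply: cvgB; [exact: cvg_cst|exact: (projT2 (cid (cR K)))].
  have hI : (fun m => complex.Im (u n K - u m K)) @ \oo --> complex.Im (u n K - l K).
    rewrite raddfB /=; under eq_fun do rewrite raddfB /=.
    by apply: cvgB; [exact: cvg_cst|exact: (projT2 (cid (cI K)))].
  by apply: cvgD; apply: cvgM.
(* [N] does not depend on [K], so the bound survives letting [K] grow; the strict inequality becomes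
   large in the limit, hence [e / 2] at the end. *)
have bound e : 0 < e -> exists N, forall n, (N <= n)%N ->
    forall K, sqsum (fun k => u n k - l k) K <= e.
  move=> /uC[N uN]; exists N => n Nn K.
  rewrite -(cvg_lim _ (ul n K)) //; apply: limr_le.
    by apply/cvg_ex; eexists; exact: ul.
  exists N => // m /= Nm.
  by apply: (le_trans (sqsum_le_l2_dot (u n - u m) K)); apply/ltW; exact: uN.
have ll : l \in @l2_pred R.
  have [N /(_ N (leqnn N)) uN] := bound 1 ltr01.
  (* Write [l] as [u N - (u N - l)]: the first term is in l^2 and the second has its partial sums
     bounded by 1. *)
  rewrite -[l](subKr (u N : nat -> R[i])); apply: rpredB; first exact: valP.
  by apply/asboolP; exists 1.
exists (L2 ll) => e e0; have [|N uN] := bound (e / 2); first by rewrite divr_gt0.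
exists N => n /uN h; apply: (@le_lt_trans _ _ (e / 2)); last first.
  by rewrite ltr_pdivrMr // ltr_pMr // ltr1n.
exact: l2_dot_le.
Qed.

Definition dirac_seq (l k : nat) : R[i] := (k == l)%:R.

Lemma dirac_l2 l : dirac_seq l \in @l2_pred R.
Proof.
apply/asboolP; exists 1 => n; rewrite /sqsum.
case: (ltnP l n) => ln.
  rewrite (bigD1 (Ordinal ln)) //= big1.
    by rewrite addr0 /dirac_seq eqxx cdotr1.
  move=> k kl; rewrite /dirac_seq (_ : (k : nat) == l = false).
    by rewrite cdotr0.
  by apply/negbTE; apply: contra kl => /eqP kl; apply/eqP/val_inj.
rewrite big1 // => k _; rewrite /dirac_seq (_ : (k : nat) == l = false).
  by rewrite cdotr0.
by apply/negbTE; rewrite neq_ltn (leq_trans (ltn_ord k) ln).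
Qed.

Definition dirac l := L2 (dirac_l2 l).

Lemma l2_nontrivial : exists u, u != 0.
Proof.
exists (dirac 0); apply/eqP => /(congr1 (fun u : l2 R => u 0%N)) /eqP.
by rewrite /= /dirac_seq eqxx oner_eq0.
Qed.

(** Only real parts of coordinates are visible to the real inner product; imaginary parts are
    reached by first multiplying the vector by a scalar. *)
Lemma l2_dot_dirac u k : l2_dot u (dirac k) = complex.Re (u k).
Proof.
apply: cvg_lim => //; apply: cvg_near_cst; exists k.+1 => // n /= kn.
rewrite /series /= big_mkord (bigD1 (Ordinal kn)) //= big1.
  by rewrite addr0 /dirac_seq eqxx cdotr1.
move=> i ik; rewrite /dirac_seq (_ : (i : nat) == k = false).
  by rewrite cdotr0.
by apply/negbTE; apply: contra ik => /eqP ik; apply/eqP/val_inj.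
Qed.

End L2Hilbert.

Definition l2_hilbert (R : realType) : hilbert R :=
  Hilbert (@l2_dotC R) (@l2_dotDl R) (@l2_dot_realZ R) (@l2_dotZ R) (@l2_dot_ge0 R)
    (@l2_dot_eq0 R) (@l2_dot_complete R) (@l2_nontrivial R).

(** * The Hilbert norm and the Cauchy-Schwarz inequality *)

Section HilbertNorm.
Variables (R : realType) (H : hilbert R).
Implicit Types (u v w : H).

Definition hnorm u : R := Num.sqrt (hdot u u).

Lemma hdotDr u v w : hdot u (v + w) = hdot u v + hdot u w.
Proof. by rewrite hdotC hdotDl !(hdotC u). Qed.

Lemma hdot0l u : hdot 0 u = 0.
Proof. by rewrite -(scale0r (0 : H)) -(rmorph0 (real_complex R)) hdot_realZ mul0r. Qed.

Lemma hdot0r u : hdot u 0 = 0.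
Proof. by rewrite hdotC hdot0l. Qed.

Lemma hdotNl u v : hdot (- u) v = - hdot u v.
Proof. by apply/eqP; rewrite -addr_eq0 -hdotDl addNr hdot0l. Qed.

Lemma hdotNr u v : hdot u (- v) = - hdot u v.
Proof. by rewrite hdotC hdotNl hdotC. Qed.

Lemma hdotZr (c : R[i]) u v : hdot u (c *: v) = hdot (conjc c *: u) v.
Proof. by rewrite hdotC hdotZ hdotC. Qed.

Lemma hdot_realZr (t : R) u v : hdot u (real_complex R t *: v) = t * hdot u v.
Proof. by rewrite hdotC hdot_realZ hdotC. Qed.

Lemma hdot_ext u v : (forall w, hdot w u = hdot w v) -> u = v.
Proof.
move=> uv; apply/eqP; rewrite -subr_eq0; apply/eqP/hdot_eq0.
by rewrite hdotDr hdotNr uv subrr.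
Qed.

Lemma hnorm_ge0 u : 0 <= hnorm u. Proof. exact: sqrtr_ge0. Qed.

Lemma sqr_hnorm u : hnorm u ^+ 2 = hdot u u.
Proof. by rewrite sqr_sqrtr // hdot_ge0. Qed.

Lemma hnorm_eq0 u : hnorm u = 0 -> u = 0.
Proof. by move=> u0; apply: hdot_eq0; rewrite -sqr_hnorm u0 expr0n. Qed.

Lemma hnorm0 : hnorm 0 = 0. Proof. by rewrite /hnorm hdot0l sqrtr0. Qed.

Lemma hdot_le u v : hdot u v <= hnorm u * hnorm v.
Proof.
have [/eqP/hnorm_eq0->|u0] := boolP (hnorm u == 0); first by rewrite hdot0l hnorm0 mul0r.
have [/eqP/hnorm_eq0->|v0] := boolP (hnorm v == 0); first by rewrite hdot0r hnorm0 mulr0.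
have up : 0 < hnorm u by rewrite lt_def u0 hnorm_ge0.
have vp : 0 < hnorm v by rewrite lt_def v0 hnorm_ge0.
(* With [a], [b] the two norms and [d] the inner product, the square of the norm of [w] is 2ab(ab -
   d); its positivity gives d <= ab. *)
set w := real_complex R (hnorm v) *: u - real_complex R (hnorm u) *: v.
have := hdot_ge0 w.
rewrite /w !(hdotDl, hdotDr, hdotNl, hdotNr, hdot_realZ, hdot_realZr) -!sqr_hnorm.
rewrite (hdotC v u); set a := hnorm u; set b := hnorm v; set d := hdot u v => h.
have : 0 <= (2 * (a * b)) * (a * b - d).
  by apply: le_trans h _; rewrite le_eqVlt; apply/orP; left; apply/eqP; ring.
by rewrite pmulr_rge0 ?mulr_gt0 // subr_ge0.
Qed.

Lemma hnormD u v : hnorm (u + v) <= hnorm u + hnorm v.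
Proof.
rewrite -ler_sqr ?nnegrE ?addr_ge0 ?hnorm_ge0 // sqr_hnorm !(hdotDl, hdotDr).
by rewrite (hdotC v) sqrrD !sqr_hnorm; have := hdot_le u v; lra.
Qed.

Lemma hnormN u : hnorm (- u) = hnorm u.
Proof. by rewrite /hnorm hdotNl hdotNr opprK. Qed.

Lemma hnorm_distC u v : hnorm (u - v) = hnorm (v - u).
Proof. by rewrite -opprB hnormN. Qed.

Lemma conjc_mul (c : R[i]) : conjc c * c = real_complex R (cdot c c).
Proof.
by rewrite /cdot; case: c => x y; apply/eqP; rewrite eq_complex /=; apply/andP; split;
  apply/eqP; ring.
Qed.

Lemma hnormZ (c : R[i]) u : hnorm (c *: u) = Num.sqrt (cdot c c) * hnorm u.
Proof.
by rewrite /hnorm hdotZ scalerA conjc_mul hdot_realZr sqrtrM // cdot_ge0.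
Qed.

Lemma hnorm_lim_complete (u : nat -> H) :
  (forall e : R, 0 < e -> exists N, forall m n, (N <= m)%N -> (N <= n)%N ->
     hnorm (u m - u n) < e) ->
  exists l, forall e : R, 0 < e -> exists N, forall n, (N <= n)%N -> hnorm (u n - l) < e.
Proof.
have sq w (e : R) : 0 < e -> (hdot w w < e ^+ 2) = (hnorm w < e).
  by move=> e0; rewrite -sqr_hnorm ltr_sqr ?nnegrE ?hnorm_ge0 // ltW.
move=> uC; have [e e0|l ul] := @hdot_complete _ H u.
  have [|N uN] := uC (Num.sqrt e); first by rewrite sqrtr_gt0.
  exists N => m n Nm Nn; have := uN m n Nm Nn.
  by rewrite -sq ?sqrtr_gt0 // sqr_sqrtr // ltW.
exists l => e e0; have [|N uN] := ul (e ^+ 2); first exact: exprn_gt0.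
by exists N => n /uN; rewrite sq.
Qed.

End HilbertNorm.

(** * The C*-algebra of uniformly bounded families of adjointable operators *)

Section Operators.
Variables (R : realType) (H : hilbert R).
Implicit Types (f g : nat -> H -> H) (u v w : H) (c d : R[i]).

Definition adjoint f g := forall j u v, hdot (f j u) v = hdot u (g j v).

Definition bounded_by f (M : R) := forall j u, hnorm (f j u) <= M * hnorm u.

(** The single [M] for all [j] makes the family a bounded operator on the direct sum; the existence
    of an adjoint is part of the definition so that the star can be obtained by choice. *)
Definition is_op f :=
  [/\ forall j c u v, f j (c *: u + v) = c *: f j u + f j v,
      exists2 M, 0 <= M & bounded_by f M &
      exists g, adjoint f g].

(* Families indexed by [nat], i.e. block diagonal operators on a countable sum of copies of [H]. *)
Record op := Op { op_val :> nat -> H -> H; op_prop : is_op op_val }.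

HB.instance Definition _ := gen_eqMixin op.
HB.instance Definition _ := gen_choiceMixin op.

Implicit Types x y z : op.

Lemma op_ext (x y : op) : (forall j u, x j u = y j u) -> x = y.
Proof.
case: x y => [f pf] [g pg] /= fg.
have E : f = g by apply/funext => j; apply/funext => u.
by case: _ / E pg => pg; congr Op; exact: Prop_irrelevance.
Qed.

Lemma opL (x : op) j c u v : x j (c *: u + v) = c *: x j u + x j v.
Proof. by case: (op_prop x). Qed.

Lemma opD (x : op) j u v : x j (u + v) = x j u + x j v.
Proof. by rewrite -[u]scale1r opL !scale1r. Qed.

Lemma op0 (x : op) j : x j 0 = 0.
Proof. by apply: (addrI (x j 0)); rewrite -opD !addr0. Qed.

Lemma opZ (x : op) j c u : x j (c *: u) = c *: x j u.
Proof. by rewrite -[c *: u]addr0 opL op0 addr0. Qed.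

Lemma is_op_zero : is_op (fun _ _ => 0).
Proof.
split=> [j c u v| |]; first by rewrite scaler0 addr0.
  by exists 0 => // j u; rewrite mul0r hnorm0.
by exists (fun _ _ => 0) => j u v; rewrite hdot0l hdot0r.
Qed.

Lemma is_op_id : is_op (fun _ u => u).
Proof.
split=> //; first by exists 1 => // j u; rewrite mul1r.
by exists (fun _ u => u).
Qed.

Lemma is_op_add (x y : op) : is_op (fun j u => x j u + y j u).
Proof.
split=> [j c u v| |].
- by rewrite !opL scalerDr; rewrite !addrA; congr (_ + _); rewrite addrAC.
- have [_ [M M0 xM] _] := op_prop x; have [_ [N N0 yN] _] := op_prop y.
  exists (M + N); first exact: addr_ge0.
  by move=> j u; rewrite mulrDl; apply: le_trans (hnormD _ _) _; rewrite lerD.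
have [_ _ [f xf]] := op_prop x; have [_ _ [g yg]] := op_prop y.
by exists (fun j u => f j u + g j u) => j u v; rewrite hdotDl hdotDr xf yg.
Qed.

Lemma is_op_opp (x : op) : is_op (fun j u => - x j u).
Proof.
have [_ [M M0 xM] [g xg]] := op_prop x.
split=> [j c u v| |]; first by rewrite opL opprD scalerN.
  by exists M => // j u; rewrite hnormN.
by exists (fun j u => - g j u) => j u v; rewrite hdotNl hdotNr xg.
Qed.

Lemma is_op_scale c (x : op) : is_op (fun j u => c *: x j u).
Proof.
have [_ [M M0 xM] [g xg]] := op_prop x.
split=> [j d u v| |]; first by rewrite opL scalerDr !scalerA mulrC.
  exists (Num.sqrt (cdot c c) * M); first by rewrite mulr_ge0 // sqrtr_ge0.
  by move=> j u; rewrite hnormZ -mulrA ler_wpM2l ?sqrtr_ge0.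
by exists (fun j u => g j (conjc c *: u)) => j u v; rewrite hdotZ xg.
Qed.

Lemma is_op_mul (x y : op) : is_op (fun j u => x j (y j u)).
Proof.
have [_ [M M0 xM] [f xf]] := op_prop x; have [_ [N N0 yN] [g yg]] := op_prop y.
split=> [j c u v| |]; first by rewrite !opL.
  exists (M * N); first exact: mulr_ge0.
  by move=> j u; apply: le_trans (xM _ _) _; rewrite -mulrA ler_wpM2l.
by exists (fun j u => g j (f j u)) => j u v; rewrite xf yg.
Qed.

Definition op_zero := Op is_op_zero.
Definition op_one := Op is_op_id.
Definition op_add x y := Op (is_op_add x y).
Definition op_opp x := Op (is_op_opp x).
Definition op_scale c x := Op (is_op_scale c x).
Definition op_mul x y := Op (is_op_mul x y).

Lemma op_addA : associative op_add.
Proof. by move=> x y z; apply: op_ext => j u /=; rewrite addrA. Qed.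
Lemma op_addC : commutative op_add.
Proof. by move=> x y; apply: op_ext => j u /=; rewrite addrC. Qed.
Lemma op_add0 : left_id op_zero op_add.
Proof. by move=> x; apply: op_ext => j u /=; rewrite add0r. Qed.
Lemma op_addN : left_inverse op_zero op_opp op_add.
Proof. by move=> x; apply: op_ext => j u /=; rewrite addNr. Qed.

HB.instance Definition _ := GRing.isZmodule.Build op op_addA op_addC op_add0 op_addN.

Lemma op_mulA : associative op_mul.
Proof. by move=> x y z; apply: op_ext. Qed.
Lemma op_mul1x : left_id op_one op_mul.
Proof. by move=> x; apply: op_ext. Qed.
Lemma op_mulx1 : right_id op_one op_mul.
Proof. by move=> x; apply: op_ext. Qed.
Lemma op_mulDl : left_distributive op_mul op_add.
Proof. by move=> x y z; apply: op_ext. Qed.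
Lemma op_mulDr : right_distributive op_mul op_add.
Proof. by move=> x y z; apply: op_ext => j u /=; rewrite opD. Qed.
Lemma op_one_neq0 : op_one != 0.
Proof.
have [u u0] := hilbert_nontrivial H; apply: contra u0 => /eqP e.
by apply/eqP; exact: (congr1 (fun x : op => x 0%N u) e).
Qed.

HB.instance Definition _ := GRing.Zmodule_isNzRing.Build op
  op_mulA op_mul1x op_mulx1 op_mulDl op_mulDr op_one_neq0.

Lemma op_scaleA c d x : op_scale c (op_scale d x) = op_scale (c * d) x.
Proof. by apply: op_ext => j u /=; rewrite scalerA. Qed.
Lemma op_scale1 : left_id 1 op_scale.
Proof. by move=> x; apply: op_ext => j u /=; rewrite scale1r. Qed.
Lemma op_scaleDr : right_distributive op_scale +%R.
Proof. by move=> c x y; apply: op_ext => j u /=; rewrite scalerDr. Qed.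
Lemma op_scaleDl x : {morph op_scale^~ x : c d / c + d}.
Proof. by move=> c d; apply: op_ext => j u /=; rewrite scalerDl. Qed.

HB.instance Definition _ := GRing.Zmodule_isLmodule.Build R[i] op
  op_scaleA op_scale1 op_scaleDr op_scaleDl.

Lemma op_scaleAl c (x y : op) : c *: (x * y) = (c *: x) * y.
Proof. by apply: op_ext. Qed.

HB.instance Definition _ := GRing.Lmodule_isLalgebra.Build R[i] op op_scaleAl.

Lemma op_scaleAr c (x y : op) : c *: (x * y) = x * (c *: y).
Proof. by apply: op_ext => j u; rewrite [RHS]opZ. Qed.

HB.instance Definition _ := GRing.Lalgebra_isAlgebra.Build R[i] op op_scaleAr.

Lemma op_addE x y j u : (x + y) j u = x j u + y j u. Proof. by []. Qed.
Lemma op_scaleE c x j u : (c *: x) j u = c *: x j u. Proof. by []. Qed.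
Lemma op_mulE x y j u : (x * y) j u = x j (y j u). Proof. by []. Qed.
Lemma op_oneE j u : (1 : op) j u = u. Proof. by []. Qed.

(** The squared norm of [g j u] is the inner product of [f j (g j u)] with [u], at most [M] times
    the norms of [g j u] and [u]; divide by the norm of [g j u]. *)
Lemma adjoint_bounded f g M : 0 <= M -> adjoint f g -> bounded_by f M -> bounded_by g M.
Proof.
move=> M0 fg fM j u.
have [->|gu0] := eqVneq (hnorm (g j u)) 0; first by rewrite mulr_ge0 ?hnorm_ge0.
have gu : 0 < hnorm (g j u) by rewrite lt_def gu0 hnorm_ge0.
rewrite -(ler_pM2l gu) -expr2 sqr_hnorm -fg; apply: le_trans (hdot_le _ _) _.
by rewrite mulrA (mulrC (hnorm (g j u))) ler_wpM2r ?hnorm_ge0.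
Qed.

Lemma adjoint_sym f g : adjoint f g -> adjoint g f.
Proof. by move=> fg j u v; rewrite hdotC -fg hdotC. Qed.

Definition op_adj (x : op) := projT1 (cid (let: And3 _ _ e := op_prop x in e)).

Lemma op_adjP (x : op) : adjoint x (op_adj x).
Proof. by rewrite /op_adj; case: cid. Qed.

Lemma is_op_star (x : op) : is_op (op_adj x).
Proof.
have xg := op_adjP x; have [_ [M M0 xM] _] := op_prop x.
split=> [j c u v| |].
- by apply: hdot_ext => w; rewrite -xg !hdotDr -xg !hdotZr -opZ xg.
- by exists M => //; exact: adjoint_bounded xM.
by exists x; exact: adjoint_sym.
Qed.

Definition op_star x := Op (is_op_star x).

Lemma op_starP (x : op) j u v : hdot (x j u) v = hdot u (op_star x j v).
Proof. exact: op_adjP. Qed.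

Lemma op_star_unique (x y : op) : (forall j u v, hdot (x j u) v = hdot u (y j v)) -> op_star x = y.
Proof.
by move=> xy; apply: op_ext => j v; apply: hdot_ext => u; rewrite -op_starP xy.
Qed.

Definition op_norm (x : op) : R := inf [set M | 0 <= M /\ bounded_by x M]%classic.

Lemma op_norm_le (x : op) M : 0 <= M -> bounded_by x M -> op_norm x <= M.
Proof. by move=> M0 xM; apply: ge_inf => //; exists 0 => N []. Qed.

Lemma op_norm_inf_nonempty (x : op) : ([set M | 0 <= M /\ bounded_by x M] !=set0)%classic.
Proof. by have [_ [M M0 xM] _] := op_prop x; exists M. Qed.

Lemma op_norm_ge0 x : 0 <= op_norm x.
Proof. by apply: lb_le_inf; [exact: op_norm_inf_nonempty|move=> M []]. Qed.

(** The infimum is attained: for nonzero [u], the ratio of the norms of [x j u] and [u] is below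
    every admissible bound, hence below their infimum. *)
Lemma op_normP (x : op) j u : hnorm (x j u) <= op_norm x * hnorm u.
Proof.
have [/eqP/hnorm_eq0->|u0] := boolP (hnorm u == 0).
  by rewrite op0 hnorm0 mulr0.
have up : 0 < hnorm u by rewrite lt_def u0 hnorm_ge0.
rewrite -ler_pdivrMr //; apply: lb_le_inf; first exact: op_norm_inf_nonempty.
by move=> M [_ xM]; rewrite ler_pdivrMr.
Qed.

Lemma op_norm_star x : op_norm (op_star x) = op_norm x.
Proof.
have le y z : adjoint y z -> op_norm z <= op_norm y.
  move=> yz; apply: op_norm_le (op_norm_ge0 _) _.
  by apply: adjoint_bounded (op_norm_ge0 _) yz _; exact: op_normP.
by apply/eqP; rewrite eq_le !le //; [exact: adjoint_sym (op_adjP _)|exact: op_adjP].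
Qed.

(** One inequality bounds [op_star x] and [x] in turn. For the other, the squared norm of [x j u] is
    the inner product of [u] with [op_star x j (x j u)], which Cauchy-Schwarz bounds through the
    norm of [op_star x * x]. *)
Lemma op_norm_cstar x : op_norm (op_star x * x) = op_norm x ^+ 2.
Proof.
apply/eqP; rewrite eq_le; apply/andP; split.
  apply: op_norm_le; first by rewrite exprn_ge0 ?op_norm_ge0.
  move=> j u; apply: le_trans (op_normP (op_star x) j (x j u)) _.
  by rewrite op_norm_star expr2 -mulrA ler_wpM2l ?op_norm_ge0 ?op_normP.
have s0 := op_norm_ge0 (op_star x * x).
rewrite -[leRHS]sqr_sqrtr // ler_sqr ?nnegrE ?op_norm_ge0 ?sqrtr_ge0 //.
apply: op_norm_le; first exact: sqrtr_ge0.
move=> j u; rewrite -ler_sqr ?nnegrE ?mulr_ge0 ?hnorm_ge0 ?sqrtr_ge0 //.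
rewrite exprMn (sqr_hnorm (x j u)) (sqr_sqrtr s0) op_starP hdotC; apply: le_trans (hdot_le _ _) _.
rewrite expr2 mulrA ler_wpM2r ?hnorm_ge0 //.
exact: (op_normP (op_star x * x)).
Qed.

Lemma op_norm_mul x y : op_norm (x * y) <= op_norm x * op_norm y.
Proof.
apply: op_norm_le; first by rewrite mulr_ge0 ?op_norm_ge0.
move=> j u; apply: le_trans (op_normP x j (y j u)) _.
by rewrite -mulrA ler_wpM2l ?op_norm_ge0 ?op_normP.
Qed.

Lemma op_norm_add x y : op_norm (x + y) <= op_norm x + op_norm y.
Proof.
apply: op_norm_le; first by rewrite addr_ge0 ?op_norm_ge0.
move=> j u; apply: le_trans (hnormD _ _) _.
by rewrite mulrDl lerD ?op_normP.
Qed.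

Lemma op_norm_eq0 x : op_norm x = 0 <-> x = 0.
Proof.
split=> [x0|->]; last first.
  apply/eqP; rewrite eq_le op_norm_ge0 op_norm_le // => j u.
  by rewrite mul0r hnorm0.
apply: op_ext => j u; apply: hnorm_eq0; apply/eqP; rewrite eq_le hnorm_ge0 andbT.
by have := op_normP x j u; rewrite x0 mul0r.
Qed.

(** The bound [le] is used twice, for [c] and, to get the reverse inequality, for the inverse of
    [c]. *)
Lemma op_norm_scale c x : op_norm (c *: x) = Num.sqrt (cdot c c) * op_norm x.
Proof.
have le d y : op_norm (d *: y) <= Num.sqrt (cdot d d) * op_norm y.
  apply: op_norm_le; first by rewrite mulr_ge0 ?op_norm_ge0 ?sqrtr_ge0.
  by move=> j u; rewrite hnormZ -mulrA ler_wpM2l ?sqrtr_ge0 ?op_normP.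
have [->|c0] := eqVneq c 0.
  by rewrite scale0r cdotr0 sqrtr0 mul0r; apply/op_norm_eq0.
apply/eqP; rewrite eq_le le /=.
have sc : Num.sqrt (cdot c c) * Num.sqrt (cdot c^-1 c^-1) = 1.
  rewrite -sqrtrM ?cdot_ge0 // -cdotMM divff // cdotr1 /=.
  exact: sqrtr1.
rewrite -[in leLHS](scale1r x) -(mulVf c0) -scalerA.
apply: le_trans (ler_wpM2l (sqrtr_ge0 _) (le _ _)) _.
by rewrite mulrA sc mul1r.
Qed.

Lemma op_complete (x : nat -> op) :
  (forall e : R, 0 < e -> exists N, forall m n : nat,
     (N <= m)%N -> (N <= n)%N -> op_norm (x m - x n) < e) ->
  exists l, forall e : R, 0 < e -> exists N, forall n : nat,
     (N <= n)%N -> op_norm (x n - l) < e.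
Proof.
(* The adjoints also converge; their limit is the adjoint of the limit. *)
have pointwise (y : nat -> op) :
  (forall e : R, 0 < e -> exists N, forall m n : nat,
     (N <= m)%N -> (N <= n)%N -> op_norm (y m - y n) < e) ->
  exists f, forall e : R, 0 < e -> exists N, forall n : nat, (N <= n)%N ->
    forall j u, hnorm (y n j u - f j u) <= e * hnorm u.
  move=> yC.
  have ex (ju : nat * H) : exists l, forall e : R, 0 < e -> exists N, forall n, (N <= n)%N ->
      hnorm (y n ju.1 ju.2 - l) < e.
    case: ju => j u /=; apply: hnorm_lim_complete => e e0.
    (* Adding 1 keeps the denominator positive when [u] is zero. *)
    have [|N yN] := yC (e / (hnorm u + 1)).
      by rewrite divr_gt0 // ltr_wpDl ?hnorm_ge0.
    exists N => m n Nm Nn; apply: le_lt_trans (op_normP (y m - y n) j u) _.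
    have := yN m n Nm Nn; rewrite ltr_pdivlMr ?ltr_wpDl ?hnorm_ge0 //.
    apply: le_lt_trans; rewrite ler_wpM2l ?op_norm_ge0 //.
    by rewrite lerDl.
  have [f yf] := choice ex.
  exists (fun j u => f (j, u)) => e e0; have [N yN] := yC e e0.
  (* [N] must be uniform in [j] and [u]: compare [y n] with a later term whose index may depend on
     them, at the cost of an arbitrary [d]. *)
  exists N => n Nn j u; apply/ler_addgt0Pr => d d0.
  have [K yK] := yf (j, u) d d0.
  have := yK (maxn N K) (leq_maxr _ _) => /= h1.
  have h2 := op_normP (y n - y (maxn N K)) j u.
  have h3 := yN n (maxn N K) Nn (leq_maxl _ _).
  rewrite -(subrKA (y (maxn N K) j u)); apply: le_trans (hnormD _ _) _.
  apply: lerD; last exact: ltW.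
  by apply: le_trans h2 _; rewrite ler_wpM2r ?hnorm_ge0 // ltW.
move=> xC.
have [f xf] := pointwise x xC.
have [|g xg] := pointwise (fun n => op_star (x n)).
  move=> e /xC[N xN]; exists N => m n Nm Nn.
  suff -> : op_star (x m) - op_star (x n) = op_star (x m - x n) by rewrite op_norm_star xN.
  apply/esym/op_star_unique => j u v /=.
  by rewrite hdotDl hdotDr hdotNl hdotNr !op_starP.
(* This turns the approximations with error proportional to [e] into exact linearity and adjointness
   of the limits. *)
have small (a b : R) : 0 <= b -> (forall e, 0 < e -> a <= e * b) -> a <= 0.
  move=> b0 ab; apply/ler_addgt0Pr => d d0; rewrite add0r.
  have bp : 0 < b + 1 by rewrite ltr_wpDl.
  apply: le_trans (ab (d / (b + 1)) (divr_gt0 d0 bp)) _.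
  by rewrite mulrAC ler_pdivrMr // ler_wpM2l ?lerDl // ltW.
have fL j c u v : f j (c *: u + v) = c *: f j u + f j v.
  apply/eqP; rewrite -subr_eq0; apply/eqP/hnorm_eq0/eqP.
  rewrite eq_le hnorm_ge0 andbT.
  apply: (small _ (hnorm (c *: u + v) + (Num.sqrt (cdot c c) * hnorm u + hnorm v))).
    by rewrite !addr_ge0 ?mulr_ge0 ?sqrtr_ge0 ?hnorm_ge0.
  move=> e /xf[N /(_ N (leqnn N) j) xN].
  have -> : f j (c *: u + v) - (c *: f j u + f j v) =
      (f j (c *: u + v) - x N j (c *: u + v)) +
      (c *: (x N j u - f j u) + (x N j v - f j v)).
    rewrite opL scalerBr (addrACA (c *: x N j u)) [RHS]addrA.
    by rewrite subrK -opprD.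
  rewrite mulrDr; apply: le_trans (hnormD _ _) (lerD _ _); first by rewrite hnorm_distC.
  rewrite mulrDr; apply: le_trans (hnormD _ _) (lerD _ _) => //.
  by rewrite hnormZ mulrCA ler_wpM2l ?sqrtr_ge0.
have fb : exists2 M, 0 <= M & bounded_by f M.
  have [N /(_ N (leqnn N)) xN] := xf 1 ltr01.
  exists (op_norm (x N) + 1); first by rewrite addr_ge0 ?op_norm_ge0.
  move=> j u; rewrite -[f j u](subKr (x N j u)) mulrDl.
  apply: le_trans (hnormD _ _) (lerD _ _); first exact: op_normP.
  by rewrite hnormN.
have fg : adjoint f g.
  move=> j u v; apply/eqP; rewrite eq_le; apply/andP; split; rewrite -subr_le0.
    apply: (small _ (hnorm u * hnorm v *+ 2)).
      by rewrite mulrn_wge0 // mulr_ge0 ?hnorm_ge0.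
    move=> e e0; have [N xN] := xf e e0; have [K xK] := xg e e0.
    have h1 := xN (maxn N K) (leq_maxl _ _) j u.
    have h2 := xK (maxn N K) (leq_maxr _ _) j v.
    set n := maxn N K in h1 h2.
    (* In the sum of [h3] and [h4] the terms in [x n] cancel by adjointness, leaving an error of at
       most [2 * e] times the two norms. *)
    have h3 := hdot_le (f j u - x n j u) v; rewrite hnorm_distC hdotDl hdotNl in h3.
    have h4 := hdot_le u (op_star (x n) j v - g j v); rewrite hdotDr hdotNr -op_starP in h4.
    have h5 := ler_wpM2r (hnorm_ge0 v) h1; have h6 := ler_wpM2l (hnorm_ge0 u) h2.
    rewrite mulr2n; nra.
  apply: (small _ (hnorm u * hnorm v *+ 2)).
    by rewrite mulrn_wge0 // mulr_ge0 ?hnorm_ge0.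
  move=> e e0; have [N xN] := xf e e0; have [K xK] := xg e e0.
  have h1 := xN (maxn N K) (leq_maxl _ _) j u.
  have h2 := xK (maxn N K) (leq_maxr _ _) j v.
  set n := maxn N K in h1 h2.
  have h3 := hdot_le (x n j u - f j u) v; rewrite hdotDl hdotNl in h3.
  have h4 := hdot_le u (g j v - op_star (x n) j v).
  rewrite hnorm_distC hdotDr hdotNr -op_starP in h4.
  have h5 := ler_wpM2r (hnorm_ge0 v) h1; have h6 := ler_wpM2l (hnorm_ge0 u) h2.
  rewrite mulr2n; nra.
exists (Op (And3 fL fb (ex_intro _ g fg))) => e e0.
have [|N xN] := xf (e / 2); first by rewrite divr_gt0.
exists N => n Nn; apply: (@le_lt_trans _ _ (e / 2)).
  apply: op_norm_le; first by rewrite ltW // divr_gt0.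
  by move=> j u; exact: xN.
by rewrite ltr_pdivrMr // ltr_pMr // ltr1n.
Qed.

Theorem op_cstar : is_cstar_algebra op_star op_norm.
Proof.
split.
- exact: op_norm_eq0.
- exact: op_norm_add.
- by move=> c x; rewrite op_norm_scale rmorphM normC_cdot.
- exact: op_norm_mul.
- exact: op_complete.
- by move=> x; apply: op_star_unique => j u v; rewrite hdotC -op_starP hdotC.
- move=> x y; apply: op_star_unique => j u v /=.
  by rewrite hdotDl hdotDr !op_starP.
- by move=> c x; apply: op_star_unique => j u v; rewrite hdotZ op_starP opZ.
- by move=> x y; apply: op_star_unique => j u v; rewrite (op_starP x) (op_starP y).
- exact: op_norm_cstar.
Qed.

End Operators.

(** * Subalgebras as algebras, closed star-subalgebras and norm closures *)

Record subalg (K : nzRingType) (B : algType K) (S : subalgClosed B) :=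
  Subalg { subalg_val : B; _ : subalg_val \in S }.

Section SubalgInstances.
Variables (K : nzRingType) (B : algType K) (S : subalgClosed B).
HB.instance Definition _ := [isSub for @subalg_val K B S].
HB.instance Definition _ := [Choice of subalg S by <:].
HB.instance Definition _ := [SubChoice_isSubAlgebra of subalg S by <:].
End SubalgInstances.

Section CstarTheory.
Variables (R : realType) (B : algType R[i]) (star : B -> B) (nrm : B -> R).
Hypothesis cs : is_cstar_algebra star nrm.
Implicit Types x y : B.

Lemma nrmZ (c : R[i]) x : nrm (c *: x) = Num.sqrt (cdot c c) * nrm x.
Proof.
have := cs_nrm_scale cs c x; rewrite normC_cdot -rmorphM.
by move=> /(congr1 (@complex.Re R)).
Qed.

Lemma nrm0 : nrm 0 = 0. Proof. exact/(cs_nrm_eq0 cs). Qed.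

Lemma nrmN x : nrm (- x) = nrm x.
Proof.
rewrite -scaleN1r nrmZ (_ : cdot _ _ = 1) ?sqrtr1 ?mul1r //.
by rewrite /cdot /=; ring.
Qed.

Lemma nrm_distC x y : nrm (x - y) = nrm (y - x).
Proof. by rewrite -opprB nrmN. Qed.

Lemma nrm_ge0 x : 0 <= nrm x.
Proof. by have := cs_nrm_triangle cs x (- x); rewrite subrr nrm0 nrmN; lra. Qed.

(** The C*-identity and submultiplicativity bound the square of [nrm y] by [nrm (star y) * nrm y];
    cancel [nrm y], then apply the result to [star x]. *)
Lemma nrm_star x : nrm (star x) = nrm x.
Proof.
have le y : nrm y <= nrm (star y).
  have [/eqP->|y0] := boolP (nrm y == 0); first exact: nrm_ge0.
  have yp : 0 < nrm y by rewrite lt_def y0 nrm_ge0.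
  rewrite -(ler_pM2r yp) -expr2 -(cs_cstar_id cs); exact: (cs_nrm_submul cs).
by apply/eqP; rewrite eq_le le andbT; have := le (star x); rewrite (cs_star_invol cs).
Qed.

Lemma star_sub x y : star (x - y) = star x - star y.
Proof.
by rewrite (cs_star_add cs) -(scaleN1r y) (cs_star_scale cs) rmorphN1 scaleN1r.
Qed.

Lemma nrm_dist_triangle x y z : nrm (x - z) <= nrm (x - y) + nrm (y - z).
Proof. by rewrite -[x - z](subrKA y); exact: (cs_nrm_triangle cs). Qed.

(** The algebraic and norm axioms restrict along [val]; closedness puts limits of Cauchy sequences
    back into [S]. *)
Lemma closed_subalg_cstar (S : subalgClosed B) :
    (forall x, x \in S -> star x \in S) ->
    (forall x, (forall e, 0 < e -> exists2 y, y \in S & nrm (x - y) < e) -> x \in S) ->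
  exists2 star' : subalg S -> subalg S, (forall a, val (star' a) = star (val a)) &
    is_cstar_algebra star' (fun a => nrm (val a)).
Proof.
move=> Sstar Scl.
pose star' (a : subalg S) : subalg S := Subalg (Sstar _ (valP a)).
exists star' => //; split.
- move=> a; split=> [/(cs_nrm_eq0 cs) a0|->]; last by rewrite raddf0 nrm0.
  by apply: val_inj; rewrite a0 raddf0.
- by move=> a b; rewrite raddfD; exact: (cs_nrm_triangle cs).
- by move=> c a; rewrite linearZ; exact: (cs_nrm_scale cs).
- by move=> a b; rewrite rmorphM; exact: (cs_nrm_submul cs).
- move=> u uC; have [e /uC[N uN]|l ul] := cs_complete cs (u := fun n => val (u n)).
    by exists N => m n Nm Nn; rewrite -raddfB; exact: uN.
  have lS : l \in S.
    apply: Scl => e /ul[N /(_ N (leqnn N)) uN]; exists (val (u N)); first exact: valP.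
    by rewrite nrm_distC.
  by exists (Subalg lS) => e /ul[N uN]; exists N => n /uN; rewrite raddfB.
- by move=> a; apply: val_inj; exact: (cs_star_invol cs).
- by move=> a b; apply: val_inj; exact: (cs_star_add cs).
- by move=> c a; apply: val_inj; exact: (cs_star_scale cs).
- by move=> a b; apply: val_inj; exact: (cs_star_mul cs).
- by move=> a; rewrite rmorphM; exact: (cs_cstar_id cs).
Qed.

Variable A0 : B -> Prop.
Hypothesis A0sub : unital_star_subalgebra star A0.

Definition nrm_closure : {pred B} :=
  fun x => `[< forall e, 0 < e -> exists y, A0 y /\ nrm (x - y) < e >].

Lemma sub_nrm_closure x : A0 x -> x \in nrm_closure.
Proof. by move=> A0x; apply/asboolP => e e0; exists x; rewrite subrr nrm0. Qed.

Lemma nrm_closureP x (e : R) : x \in nrm_closure -> 0 < e ->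
  exists y, A0 y /\ nrm (x - y) < e.
Proof. by move=> /asboolP xcl /xcl. Qed.

Lemma nrm_closure_closed x :
  (forall e, 0 < e -> exists2 y, y \in nrm_closure & nrm (x - y) < e) -> x \in nrm_closure.
Proof.
move=> xcl; apply/asboolP => e e0.
have e2 : 0 < e / 2 by rewrite divr_gt0.
have [y ycl xy] := xcl _ e2; have [z [A0z yz]] := nrm_closureP ycl e2.
exists z; split=> //; apply: le_lt_trans (nrm_dist_triangle x y z) _; lra.
Qed.

Lemma nrm_closure_star x : x \in nrm_closure -> star x \in nrm_closure.
Proof.
move=> xcl; apply/asboolP => e e0; have [y [A0y xy]] := nrm_closureP xcl e0.
exists (star y); split; first by case: A0sub => _ _ _ _; apply.
by rewrite -star_sub nrm_star.
Qed.

Lemma nrm_closure_subalg : subalg_closed nrm_closure.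
Proof.
have [A1 AD AZ AM _] := A0sub; split.
- exact: sub_nrm_closure.
- move=> c x y xcl ycl; apply/asboolP => e e0.
  have c0 : 0 <= Num.sqrt (cdot c c) by exact: sqrtr_ge0.
  have d0 : 0 < e / (Num.sqrt (cdot c c) + 1) by rewrite divr_gt0 // ltr_wpDl.
  have [x' [Ax' xx']] := nrm_closureP xcl d0; have [y' [Ay' yy']] := nrm_closureP ycl d0.
  exists (c *: x' + y'); split; first exact/AD/Ay'/AZ.
  rewrite opprD addrACA -scalerBr; apply: le_lt_trans (cs_nrm_triangle cs _ _) _.
  rewrite nrmZ.
  have -> : e = Num.sqrt (cdot c c) * (e / (Num.sqrt (cdot c c) + 1)) +
      e / (Num.sqrt (cdot c c) + 1).
    by field; rewrite gt_eqF // ltr_wpDl.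
  by apply: ler_ltD => //; rewrite ler_wpM2l // ltW.
move=> x y xcl ycl; apply/asboolP => e e0.
have x0 := nrm_ge0 x; have y0 := nrm_ge0 y.
pose M := nrm x + nrm y + 1.
have M0 : 0 < M by rewrite /M; lra.
have eM : 0 < e / (2 * M) by rewrite divr_gt0 // mulr_gt0.
have [y' [Ay' yy']] := nrm_closureP ycl eM.
(* The approximant [y'] is fixed first, so that the tolerance for [x] may depend on its norm; each
   half of the splitting of [x * y - x' * y'] then costs at most [e / 2]. *)
have dM : 0 < e / (2 * (M + nrm y')).
  by rewrite divr_gt0 // mulr_gt0 // ltr_wpDr ?nrm_ge0.
have [x' [Ax' xx']] := nrm_closureP xcl dM.
exists (x' * y'); split; first exact: AM.
have -> : x * y - x' * y' = x * (y - y') + (x - x') * y'.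
  by rewrite mulrBr mulrBl subrKA.
apply: le_lt_trans (cs_nrm_triangle cs _ _) _.
have h1 : nrm (x * (y - y')) <= e / 2.
  apply: le_trans (cs_nrm_submul cs _ _) _.
  apply: (@le_trans _ _ (M * (e / (2 * M)))).
    by rewrite ler_pM ?nrm_ge0 ?(ltW yy') // /M; lra.
  by rewrite le_eqVlt; apply/orP; left; apply/eqP; field; rewrite gt_eqF.
have h2 : nrm ((x - x') * y') < e / 2.
  apply: le_lt_trans (cs_nrm_submul cs _ _) _.
  have P0 : 0 < M + nrm y' by rewrite ltr_wpDr ?nrm_ge0.
  apply: (@le_lt_trans _ _ (e / (2 * (M + nrm y')) * nrm y')).
    by rewrite ler_wpM2r ?nrm_ge0 // ltW.
  rewrite (_ : e / 2 = e / (2 * (M + nrm y')) * (M + nrm y')).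
    by rewrite ltr_pM2l // ltrDr.
  by field; rewrite gt_eqF.
lra.
Qed.

End CstarTheory.

(** An n by n array of N by N blocks is one square matrix over a field, for which a right inverse is
    also a left inverse. *)
Lemma block_mulmx1C (K : fieldType) n N (X Y : 'I_n -> 'I_n -> 'M[K]_N) :
  (forall i k, \sum_j X i j *m Y j k = if i == k then 1%:M else 0) ->
  forall i k, \sum_j Y i j *m X j k = if i == k then 1%:M else 0.
Proof.
have one : \mxblock_(i < n, k < n) (if i == k then 1%:M else 0 : 'M[K]_N) = 1%:M.
  rewrite -mxdiagZ; apply: eq_mxblock => i k; case: eqVneq => // _.
  by rewrite conform_mx_id.
move=> XY.
have : (\mxblock_(i < n, j < n) X i j) *m (\mxblock_(j < n, k < n) Y j k) = 1%:M.
  by rewrite mul_mxblock -one; apply: eq_mxblock.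
by move=> /mulmx1C; rewrite mul_mxblock -one => /eq_mxblockP.
Qed.

(** * The stably finite star-algebra with polynomial matrix entries *)

Section DensePolynomials.
Variable R : realType.
Local Notation C := R[i].
Local Notation H := (l2_hilbert R).
Implicit Types (x y : op H) (p q : {poly C}).

Lemma l2_addE (u v : l2 R) k : (u + v) k = u k + v k. Proof. by []. Qed.
Lemma l2_scaleE c (u : l2 R) k : (c *: u) k = c * u k. Proof. by []. Qed.

Lemma l2_sumE I (r : seq I) (F : I -> l2 R) k : (\sum_(i <- r) F i) k = \sum_(i <- r) F i k.
Proof. by apply: (big_morph (fun u : l2 R => u k)). Qed.

(** The multipliers 1 and i recover the real and imaginary parts. *)
Lemma eq_complex_Re (a b : C) : (forall c, complex.Re (c * a) = complex.Re (c * b)) -> a = b.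
Proof.
move=> ab; have := ab 1; have := ab 'i%C; case: a b {ab} => [x y] [x' y'] /=.
rewrite !mul0r !mul1r !sub0r !subr0 => /oppr_inj -> ->.
by [].
Qed.

Definition entry x j k l : C := (x j (dirac R l) : l2 R) k.

Lemma hdot_dirac (u : H) k : hdot u (dirac R k) = complex.Re ((u : l2 R) k).
Proof. exact: l2_dot_dirac. Qed.

Lemma entry_star x j k l : entry (op_star x) j k l = conjc (entry x j l k).
Proof.
apply: eq_complex_Re => c; rewrite -l2_scaleE -(hdot_dirac (c *: _)).
rewrite -opZ hdotC -op_starP hdotZr hdot_dirac l2_scaleE -[(x j _ : l2 R) l]/(entry x j l k).
by case: c (entry x j l k) => [a b] [a' b'] /=; ring.
Qed.

Definition grid j : R := 2^-1 ^+ j.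

Lemma grid_inj : injective grid.
Proof.
apply: ieexprIn; first by rewrite invr_gt0.
by rewrite lt_eqF // invf_lt1 ?ltr1n.
Qed.

(** The points [grid 1], ..., [grid (size p)] are distinct, which is one root too many for a nonzero
    [p]. As [j = 0] is left out of the hypothesis, vanishing on the other blocks forces vanishing
    there. *)
Lemma poly_grid_eq0 p : (forall j, (0 < j)%N -> p.[real_complex R (grid j)] = 0) -> p = 0.
Proof.
move=> p0; apply/eqP/negP => /negP pn0.
pose rs := [seq real_complex R (grid j) | j <- iota 1 (size p)].
have : (size rs < size p)%N.
  apply: max_poly_roots => //.
    by apply/allP => _ /mapP[j + ->]; rewrite mem_iota => /andP[j0 _]; apply/eqP/p0.
  rewrite map_inj_uniq ?iota_uniq // => i j /(congr1 (@complex.Re R)).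
  exact: grid_inj.
by rewrite size_map size_iota ltnn.
Qed.

(** The polynomials and the band width [d] serve all [j] at once. The band makes entries of products
    finite sums; the last clause makes block [j >= 1] a j by j matrix plus a diagonal operator. *)
Definition A0 x := exists (p : nat -> nat -> {poly C}) d,
  [/\ forall j k l, entry x j k l = (p k l).[real_complex R (grid j)],
      forall k l, (l + d < k)%N || (k + d < l)%N -> p k l = 0 &
      forall j k l, (0 < j)%N -> k != l -> (j <= maxn k l)%N -> entry x j k l = 0].

Lemma l2_dirac_sum (u : l2 R) M : (forall r, (M <= r)%N -> u r = 0) ->
  u = \sum_(r < M) u r *: dirac R r.
Proof.
move=> u0; apply: l2_ext => k; rewrite l2_sumE.
under eq_bigr do rewrite l2_scaleE /= /dirac_seq.
have [kM|Mk] := ltnP k M.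
  rewrite (bigD1 (Ordinal kM)) //= eqxx mulr1 big1 ?addr0 // => r rk.
  rewrite (_ : k == r = false) ?mulr0 //.
  by apply/negbTE; apply: contra rk => /eqP rk; apply/eqP/val_inj.
rewrite u0 // big1 // => r _; rewrite (_ : k == r = false) ?mulr0 //.
by apply/negbTE; rewrite neq_ltn (leq_trans (ltn_ord r) Mk) orbT.
Qed.

Lemma op_sum x j I (r : seq I) (F : I -> H) : x j (\sum_(i <- r) F i) = \sum_(i <- r) x j (F i).
Proof. exact: (big_morph (x j) (opD x j) (op0 x j)). Qed.

(** Column [l] of [y] is a finite combination of basis vectors, so linearity of [x] yields the
    matrix product. *)
Lemma entry_mul x y j k l M : (forall r, (M <= r)%N -> entry y j r l = 0) ->
  entry (x * y) j k l = \sum_(r < M) entry x j k r * entry y j r l.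
Proof.
move=> y0; rewrite /entry /= [in LHS](l2_dirac_sum y0) (op_sum x j) l2_sumE.
by apply: eq_bigr => r _; rewrite opZ; exact: mulrC.
Qed.

Lemma entry_add x y j k l : entry (x + y) j k l = entry x j k l + entry y j k l.
Proof. by rewrite /entry op_addE l2_addE. Qed.

Lemma entry_scale c x j k l : entry (c *: x) j k l = c * entry x j k l.
Proof. by rewrite /entry op_scaleE l2_scaleE. Qed.

Lemma entry_one j k l : entry 1 j k l = (k == l)%:R.
Proof. by rewrite /entry op_oneE. Qed.

(** The entries of the star vanish too, so it kills every basis vector; coordinates of [x j u] are
    read off by pairing [u] with these images. *)
Lemma entry_eq0 x : (forall j k l, entry x j k l = 0) -> x = 0.
Proof.
move=> x0; apply: op_ext => j u; apply: l2_ext => k; apply: eq_complex_Re => c.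
rewrite -l2_scaleE -(hdot_dirac (c *: _)) -opZ op_starP.
rewrite (_ : op_star x j (dirac R k) = 0) ?hdot0r ?mulr0 //.
by apply: l2_ext => r; rewrite -[LHS]/(entry _ _ _ _) entry_star x0 rmorph0.
Qed.

Lemma A0_one : A0 1.
Proof.
exists (fun k l => (k == l)%:R%:P), 0%N; split=> [j k l|k l kl|j k l _ kl _].
- by rewrite entry_one hornerC.
- by rewrite (_ : k == l = false) //; lia.
- by rewrite entry_one (negbTE kl).
Qed.

Lemma A0_add x y : A0 x -> A0 y -> A0 (x + y).
Proof.
move=> [p [d [xp pd xd]]] [q [e [yq qe ye]]].
exists (fun k l => p k l + q k l), (d + e)%N; split=> [j k l|k l kl|j k l j0 kl jkl].
- by rewrite entry_add xp yq hornerD.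
- by rewrite pd ?qe ?addr0 //; lia.
- by rewrite entry_add xd // ye // addr0.
Qed.

Lemma A0_scale c x : A0 x -> A0 (c *: x).
Proof.
move=> [p [d [xp pd xd]]].
exists (fun k l => c *: p k l), d; split=> [j k l|k l kl|j k l j0 kl jkl].
- by rewrite entry_scale xp hornerZ.
- by rewrite pd // scaler0.
- by rewrite entry_scale xd // mulr0.
Qed.

Lemma A0_zero : A0 0.
Proof. by rewrite -(scale0r 1); exact/A0_scale/A0_one. Qed.

Lemma A0_mul x y : A0 x -> A0 y -> A0 (x * y).
Proof.
move=> [p [d [xp pd xd]]] [q [e [yq qe ye]]].
(* The range of summation depends on [l] and the band of [y] but not on [j], so the same polynomials
   describe all blocks. *)
have xy j k l : entry (x * y) j k l = \sum_(r < (l + e).+1) entry x j k r * entry y j r l.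
  by apply: entry_mul => r lr; rewrite yq qe ?horner0 ?lr.
exists (fun k l => \sum_(r < (l + e).+1) p k r * q r l), (d + e)%N.
split=> [j k l|k l kl|j k l j0 kl jkl].
- by rewrite xy horner_sum; apply: eq_bigr => r _; rewrite hornerM xp yq.
- apply: big1 => r _; have rl := ltn_ord r.
  have [rd|rd] := boolP ((r + d < k)%N || (k + d < r)%N); first by rewrite pd // mul0r.
  by rewrite (qe r) ?mulr0 //; lia.
(* If [r] is [k] or [l], one factor is the forbidden entry [(k, l)]. Otherwise both factors are
   off-diagonal, and whichever of [k], [l] is at least [j] kills its factor. *)
rewrite xy; apply: big1 => r _; have [<-|rk] := eqVneq k r.
  by rewrite (ye _ k) ?mulr0.
have [rl|rl] := eqVneq (r : nat) l; first by rewrite rl xd // mul0r.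
have [jk|jk] := leqP j (maxn k r); first by rewrite xd // mul0r.
by rewrite (ye _ r) ?mulr0 //; lia.
Qed.

Lemma A0_star x : A0 x -> A0 (op_star x).
Proof.
move=> [p [d [xp pd xd]]].
(* Transpose and conjugate the coefficients; the grid points are real, so evaluation commutes with
   conjugation. *)
exists (fun k l => map_poly (@conjc R) (p l k)), d; split=> [j k l|k l kl|j k l j0 kl jkl].
- by rewrite entry_star xp -horner_map /= oppr0.
- by rewrite pd ?rmorph0 //; lia.
- by rewrite entry_star xd ?rmorph0 // ?(eq_sym l) // maxnC.
Qed.

Lemma A0_star_subalgebra : unital_star_subalgebra (@op_star R H) A0.
Proof.
split; [exact: A0_one|exact: A0_add|exact: A0_scale|exact: A0_mul|exact: A0_star].
Qed.

Definition trunc j N x : 'M[C]_N := \matrix_(k, l) entry x j k l.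

(** Once [N] reaches [j], the first [N] columns of block [j] of [y] have no entry below row [N], so
    cutting to the corner loses no term of the product. *)
Lemma trunc_mul j N x y : (0 < j)%N -> (j <= N)%N -> A0 y ->
  trunc j N (x * y) = trunc j N x *m trunc j N y.
Proof.
move=> j0 jN [q [e [_ _ ye]]]; apply/matrixP => k l; rewrite !mxE (@entry_mul x y j k l N).
  by apply: eq_bigr => r _; rewrite !mxE.
move=> r Nr; have lN := ltn_ord l; apply: ye => //; lia.
Qed.

Lemma trunc_sum j N I (r : seq I) (F : I -> op H) :
  trunc j N (\sum_(i <- r) F i) = \sum_(i <- r) trunc j N (F i).
Proof.
apply: big_morph => [x y|]; apply/matrixP => k l; rewrite !mxE //.
Qed.

Lemma A0_stably_finite : stably_finite_sub A0.
Proof.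
move=> n X Y XA YA XY.
have A0_sum I (r : seq I) (F : I -> op H) : (forall i, A0 (F i)) -> A0 (\sum_(i <- r) F i).
  move=> FA; apply: big_ind => //; last by move=> *; exact: A0_add.
  exact: A0_zero.
have trunc_one j N (b : bool) : trunc j N (b%:R) = if b then 1%:M else 0.
  by case: b; apply/matrixP => k l; rewrite !mxE.
(* On blocks [j >= 1] the corners turn [X Y = 1] into an identity between block matrices over the
   complex numbers. *)
have YX_trunc j N : (0 < j)%N -> (j <= N)%N ->
    forall i k, trunc j N ((Y *m X) i k) = if i == k then 1%:M else 0.
  move=> j0 jN i k; rewrite mxE trunc_sum.
  under eq_bigr do rewrite trunc_mul //.
  apply: (block_mulmx1C (X := fun i j' => trunc _ _ (X i j'))
                        (Y := fun i j' => trunc _ _ (Y i j'))).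
  move=> {}i {}k; have /matrixP/(_ i k) := XY; rewrite !mxE => /(congr1 (trunc j N)).
  by rewrite trunc_sum trunc_one; under eq_bigr do rewrite trunc_mul //.
apply/matrixP => i k; rewrite [RHS]mxE; apply/eqP; rewrite -subr_eq0; apply/eqP.
have [p [d [zp _ _]]] : A0 ((Y *m X) i k - (i == k)%:R).
  apply: A0_add; first by rewrite mxE; apply: A0_sum => r; exact: A0_mul.
  rewrite -scaleN1r; apply: A0_scale.
  by case: (i == k); [exact: A0_one|exact: A0_zero].
apply: entry_eq0 => j a b; rewrite zp (_ : p a b = 0) ?horner0 //.
apply: poly_grid_eq0 => {}j j0; rewrite -zp.
(* Large enough for truncation to be multiplicative on block [j] and for the corner to contain the
   entry [(a, b)]. *)
pose N := (maxn j (maxn a b)).+1.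
have [jN aN bN] : [/\ (j <= N)%N, (a < N)%N & (b < N)%N] by rewrite /N; split; lia.
have := YX_trunc j N j0 jN i k; rewrite -(trunc_one j) => /matrixP/(_ (Ordinal aN) (Ordinal bN)).
rewrite [LHS]mxE [RHS]mxE /= => e.
by rewrite entry_add e -entry_add subrr.
Qed.

End DensePolynomials.

(** * Weighted shifts and their adjoints *)

Section WeightedShift.
Local Open Scope classical_set_scope.
Variables (R : realType) (w : nat -> nat -> R).
Hypothesis w1 : forall j k, `|w j k| <= 1.
Local Notation C := R[i].
Local Notation H := (l2_hilbert R).
Local Notation "r %:C" := (real_complex R r).

Definition shift_seq j (u : nat -> C) k : C := if k is k'.+1 then (w j k')%:C * u k' else 0.
Definition back_seq j (u : nat -> C) k : C := (w j k)%:C * u k.+1.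

Lemma cdot_weight j k (a : C) : cdot ((w j k)%:C * a) ((w j k)%:C * a) <= cdot a a.
Proof.
rewrite cdotMM [cdot _%:C _]/cdot /= mulr0 addr0 ler_piMl ?cdot_ge0 //.
rewrite -expr2 -real_normK ?num_real //.
by rewrite exprn_ile1.
Qed.

Lemma sqsum_shift j u n : sqsum (shift_seq j u) n <= sqsum u n.
Proof.
case: n => [|n]; first by rewrite /sqsum !big_ord0.
rewrite /sqsum big_ord_recl /= cdotr0 add0r big_ord_recr /=.
by rewrite ler_wpDr ?cdot_ge0 // ler_sum // => k _; exact: cdot_weight.
Qed.

Lemma sqsum_back j u n : sqsum (back_seq j u) n <= sqsum u n.+1.
Proof.
rewrite /sqsum big_ord_recl /= ler_wpDl ?cdot_ge0 // ler_sum // => k _.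
exact: cdot_weight.
Qed.

Lemma shift_l2 j (u : l2 R) : shift_seq j u \in @l2_pred R.
Proof.
have /asboolP[M uM] := valP u; apply/asboolP; exists M => n.
by apply: le_trans (uM n); exact: sqsum_shift.
Qed.

Lemma back_l2 j (u : l2 R) : back_seq j u \in @l2_pred R.
Proof.
have /asboolP[M uM] := valP u; apply/asboolP; exists M => n.
by apply: le_trans (uM n.+1); exact: sqsum_back.
Qed.

Definition shift_fun j (u : H) : H := L2 (shift_l2 j u).
Definition back_fun j (u : H) : H := L2 (back_l2 j u).

Lemma shift_adjoint : adjoint shift_fun back_fun.
Proof.
move=> j u v; rewrite /= /l2_dot; apply: cvg_lim => //.
(* The shifted sequence starts with 0, so dropping the term of index 0 turns one series into the
   other. *)
rewrite -cvg_shiftS.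
have -> : (fun n => series (fun k => cdot (shift_seq j u k) ((v : l2 R) k)) n.+1) =
    series (fun k => cdot ((u : l2 R) k) (back_seq j v k)).
  apply/funext => n; rewrite /series /= big_nat_recl //= cdotC cdotr0 add0r.
  by apply: eq_bigr => k _; rewrite cdotZ conjc_real.
exact: (@cvg_l2_dot _ u (back_fun j v)).
Qed.

Lemma shift_seqL j c u v k :
  shift_seq j (fun i => c * u i + v i) k = c * shift_seq j u k + shift_seq j v k.
Proof. by case: k => [|k] /=; [rewrite mulr0 addr0|rewrite mulrDr mulrCA]. Qed.

Lemma is_op_shift : is_op shift_fun.
Proof.
split; last by exists back_fun; exact: shift_adjoint.
  by move=> j c u v; apply: l2_ext => k; exact: shift_seqL.
exists 1 => // j u; rewrite mul1r ler_wsqrtr //; apply: l2_dot_le => n.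
apply: le_trans (sqsum_le_l2_dot u n); exact: sqsum_shift.
Qed.

Definition op_shift := Op is_op_shift.

Lemma op_star_shift j u : op_star op_shift j u = back_fun j u.
Proof. by apply: hdot_ext => v; rewrite -op_starP; exact: shift_adjoint. Qed.

Lemma entry_shift j k l : entry op_shift j k l = if k == l.+1 then (w j l)%:C else 0.
Proof.
rewrite /entry /=; case: k => [|k] //=; rewrite /dirac_seq eqSS.
by case: eqVneq => [->|]; rewrite ?mulr1 ?mulr0.
Qed.

End WeightedShift.

(** * A non-unitary isometry in the norm closure *)

Section Isometry.
Variable R : realType.
Local Notation H := (l2_hilbert R).
Local Notation "r %:C" := (real_complex R r).

Lemma grid_ge0 j : 0 <= grid R j.
Proof. by rewrite exprn_ge0 // invr_ge0. Qed.

Lemma grid_le1 j : grid R j <= 1.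
Proof. by rewrite exprn_ile1 ?invr_ge0 // invf_le1 ?ler1n. Qed.

Lemma grid_le_half j : grid R j.+1 <= 2^-1.
Proof. by rewrite /grid exprS ler_piMr ?grid_le1 // invr_ge0. Qed.

Lemma is_op_central : is_op (fun j (u : H) => (grid R j)%:C *: u).
Proof.
split; last by exists (fun j (u : H) => (grid R j)%:C *: u) => j u v; rewrite hdotZ conjc_real.
  by move=> j c u v; rewrite scalerDr !scalerA mulrC.
exists 1 => // j u; rewrite hnormZ ler_wpM2r ?hnorm_ge0 //.
by rewrite /cdot /= mulr0 addr0 -expr2 sqrtr_sqr ger0_norm ?grid_ge0 ?grid_le1.
Qed.

(** The parameter [h]: it is 1 on block 0 and at most 1/2 on the others, so its powers tend in norm
    to the projection onto block 0. *)
Definition op_central := Op is_op_central.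

Lemma op_centralX m j u : (op_central ^+ m) j u = (grid R j ^+ m)%:C *: u.
Proof.
elim: m u => [|m IH] u; first by rewrite expr0 expr0 scale1r.
by rewrite exprS op_mulE IH /= scalerA -rmorphM -exprS.
Qed.

Lemma entry_central j k l : entry op_central j k l = (grid R j)%:C * (k == l)%:R.
Proof. exact: l2_scaleE. Qed.

Lemma A0_central : A0 op_central.
Proof.
exists (fun k l => (k == l)%:R *: 'X), 0%N; split=> [j k l|k l kl|j k l j0 kl _].
- by rewrite entry_central hornerZ hornerX mulrC.
- by rewrite (_ : k == l = false) ?scale0r //; lia.
by rewrite entry_central (negbTE kl) mulr0.
Qed.

(** A Lagrange-type product with value 1 at [grid 0] and roots [grid 1], ..., [grid k.+1]. The last
    root is needed since the weight sits at entry [(k.+1, k)], which [A0] requires to vanish for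
    [1 <= j <= k.+1]. *)
Definition weight_poly k : {poly R} :=
  \prod_(i < k.+1) ((1 - grid R i.+1)^-1 *: ('X - (grid R i.+1)%:P)).

Definition weight j k := (weight_poly k).[grid R j].

Lemma weightE j k :
  weight j k = \prod_(i < k.+1) ((1 - grid R i.+1)^-1 * (grid R j - grid R i.+1)).
Proof.
by rewrite /weight horner_prod; apply: eq_bigr => i _; rewrite hornerZ hornerXsubC.
Qed.

Lemma sub1_grid_gt0 i : 0 < 1 - grid R i.+1.
Proof. by rewrite subr_gt0; apply: le_lt_trans (grid_le_half i) _; rewrite invf_lt1 ?ltr1n. Qed.

(** Each factor is (t - s) / (1 - s) with t in [0, 1] and s at most 1/2, so t - s lies between -s
    and 1 - s, and s <= 1 - s. *)
Lemma weight_le1 j k : `|weight j k| <= 1.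
Proof.
rewrite weightE normr_prod; apply: prodr_ile1 => i _; rewrite normr_ge0 /=.
have g0 := sub1_grid_gt0 i.
rewrite normrM gtr0_norm ?invr_gt0 // mulrC ler_pdivrMr // mul1r ler_norml.
have := grid_ge0 j; have := grid_le1 j; have := grid_le_half i.
have : (2 : R)^-1 = 1 - 2^-1 by field.
by move: (2^-1) => t *; apply/andP; split; lra.
Qed.

Lemma weight0 k : weight 0 k = 1.
Proof.
rewrite weightE big1 // => i _; rewrite [grid R 0]expr0 mulVf // gt_eqF //.
exact: sub1_grid_gt0.
Qed.

Lemma weight_vanish j k : (0 < j)%N -> (j <= k.+1)%N -> weight j k = 0.
Proof.
case: j => // j _ jk; rewrite weightE (bigD1 (Ordinal jk)) //=.
by rewrite subrr mulr0 mul0r.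
Qed.

(** On block 0 all weights are 1, giving the unilateral shift; on block [j >= 1] only the steps
    inside the first [j] coordinates can survive. *)
Definition op_a := op_shift weight_le1.

Lemma A0_a : A0 op_a.
Proof.
exists (fun k l => if k == l.+1 then map_poly (real_complex R) (weight_poly l) else 0), 1%N.
split=> [j k l|k l kl|j k l j0 kl jkl]; last 1 first.
- rewrite entry_shift; case: eqP => // kE; rewrite weight_vanish //; lia.
- by rewrite entry_shift; case: eqP => // _; rewrite ?horner0 // horner_map.
by rewrite (_ : k == l.+1 = false) //; lia.
Qed.

Lemma is_op_glue (x y : op H) : is_op (fun j u => if j == 0%N then x j u else y j u).
Proof.
have [_ [M M0 xM] [f xf]] := op_prop x; have [_ [N N0 yN] [g yg]] := op_prop y.
split.
- by move=> j c u v; case: ifP => _; exact: opL.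
- exists (M + N) => [|j u]; first exact: addr_ge0.
  rewrite mulrDl; case: ifP => _.
    by rewrite ler_wpDr ?mulr_ge0 ?hnorm_ge0.
  by rewrite ler_wpDl ?mulr_ge0 ?hnorm_ge0.
by exists (fun j u => if j == 0%N then f j u else g j u) => j u v; case: ifP.
Qed.

Definition op_glue x y := Op (is_op_glue x y).

Lemma op_star_glue x y : op_star (op_glue x y) = op_glue (op_star x) (op_star y).
Proof. by apply: op_star_unique => -[|j] u v; [exact: (op_starP x)|exact: (op_starP y)]. Qed.

Definition isometry := op_glue op_a 1.

Lemma isometryP : op_star isometry * isometry = 1.
Proof.
rewrite op_star_glue; apply: op_ext => -[|j] u.
  rewrite -[LHS]/(op_star op_a 0 (op_a 0 u)) op_star_shift; apply: l2_ext => k.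
  by rewrite /= /back_seq /= weight0 !mul1r.
by rewrite -[LHS]/(op_star 1 j.+1 u) (op_star_unique (x := 1) (y := 1)).
Qed.

(** On block 0 the range of the shift misses the first basis vector, so the entry [(0, 0)] of the
    product is 0. *)
Lemma isometry_not_unitary : isometry * op_star isometry <> 1.
Proof.
move=> /(congr1 (fun x : op H => (x 0%N (dirac R 0) : l2 R) 0%N)) /eqP.
by rewrite op_oneE /= /dirac_seq eqxx eq_sym oner_eq0.
Qed.

Lemma isometry_approx (e : R) : 0 < e -> exists y, A0 y /\ op_norm (isometry - y) < e.
Proof.
(* The added 1 makes [D] positive, as the division by [e] and the choice of a power of 2 above
   [D / e] use. *)
move=> e0; pose D := op_norm (op_a - 1) + 1.
have D0 : 0 < D by rewrite ltr_wpDl ?op_norm_ge0.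
have [m mD] : exists m, D * 2^-1 ^+ m < e.
  exists (Num.bound (D / e)); rewrite exprVn ltr_pdivrMr ?exprn_gt0 // mulrC.
  by rewrite -ltr_pdivrMr //; exact: upper_nthrootP.
exists (op_central ^+ m * (op_a - 1) + 1); split.
  apply: A0_add; last exact: A0_one.
  apply: A0_mul.
    elim: m {mD} => [|m IH]; first by rewrite expr0; exact: A0_one.
    by rewrite exprS; apply: A0_mul => //; exact: A0_central.
  by rewrite -scaleN1r; apply: (A0_add A0_a); apply: A0_scale; exact: A0_one.
apply: le_lt_trans mD; apply: op_norm_le.
  by rewrite mulr_ge0 ?exprn_ge0 ?invr_ge0 // ltW.
move=> j u.
have -> : (isometry - (op_central ^+ m * (op_a - 1) + 1)) j u =
    isometry j u - ((grid R j ^+ m)%:C *: ((op_a - 1) j u) + u).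
  by rewrite -op_centralX.
have half0 : 0 <= (2^-1 : R) by rewrite invr_ge0.
have [->|j0] := eqVneq j 0%N.
  (* On block 0 the parameter is 1 and the approximant equals [op_a] exactly. *)
  rewrite (_ : _ - _ = 0).
    by rewrite hnorm0 !mulr_ge0 ?hnorm_ge0 ?exprn_ge0 // ltW.
  rewrite [grid R 0]expr0 expr1n scale1r [(op_a - 1) _ _]/(op_a 0%N u - u) subrK.
  by rewrite subrr.
(* On the other blocks the identities cancel, leaving [op_a - 1] scaled by [- grid R j ^+ m], of
   absolute value at most [2^-1 ^+ m]. *)
rewrite [isometry j u]/= (negbTE j0) opprD addrCA subrr addr0 hnormN hnormZ.
rewrite [D * _]mulrC -mulrA; apply: ler_pM; [exact: sqrtr_ge0|exact: hnorm_ge0|..].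
  rewrite /cdot /= mulr0 addr0 -expr2 sqrtr_sqr ger0_norm ?exprn_ge0 ?grid_ge0 //.
  case: j j0 => // j _; apply: lerXn2r; rewrite ?nnegrE ?grid_ge0 //.
  exact: grid_le_half.
apply: (le_trans (op_normP (op_a - 1) j u)).
by rewrite ler_wpM2r ?hnorm_ge0 // lerDl.
Qed.

End Isometry.

(** * The norm closure of the polynomial algebra *)

Theorem theorem1p1 (R : realType) :
  exists (A : algType R[i]) (star : A -> A) (nrm : A -> R) (A0 : A -> Prop),
    [/\ is_cstar_algebra star nrm,
        ~ finite_ring A,
        unital_star_subalgebra star A0,
        norm_dense nrm A0 &
        stably_finite_sub A0].
Proof.
pose B := op (l2_hilbert R).
have cs : is_cstar_algebra (@op_star R _ : B -> B) (@op_norm R _) := op_cstar _.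
have sub := A0_star_subalgebra R.
pose cl := nrm_closure (@op_norm R _ : B -> R) (@A0 R).
have clS : subalg_closed cl := nrm_closure_subalg cs sub.
pose clM := GRing.isSubalgClosed.Build R[i] B cl clS.
pose S : subalgClosed B := HB.pack cl clM.
have [||star' star'E cs'] := closed_subalg_cstar cs (S := S).
- by move=> x; exact: (nrm_closure_star cs sub).
- by move=> x; exact: (nrm_closure_closed cs).
exists (subalg S : algType R[i]), star', (fun a => op_norm (val a)), (fun a => A0 (val a)).
split=> //.
(* Finiteness would turn the isometry, which lies in the closure, into a unitary. *)
- move=> fin.
  have vS : isometry R \in S by apply/asboolP => e e0; exact: isometry_approx.
  pose v : subalg S := Subalg vS.
  have vv : star' v * v = 1.
    apply: val_inj.
    exact: etrans (congr1 (fun z => z * isometry R) (star'E v)) (isometryP R).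
  apply: (@isometry_not_unitary R).
  by rewrite -[op_star _](star'E v); exact: (congr1 val (fin _ _ vv)).
- have [A1 AD AZ AM AS] := sub; split.
  + by rewrite rmorph1.
  + by move=> a b; rewrite raddfD; exact: AD.
  + by move=> c a; rewrite linearZ; exact: AZ.
  + by move=> a b; rewrite rmorphM; exact: AM.
  + by move=> a; rewrite star'E; exact: AS.
- move=> a e e0; have [y [Ay ay]] := nrm_closureP (valP a) e0.
  have yS : y \in S by exact: (sub_nrm_closure cs).
  by exists (Subalg yS : subalg S); rewrite raddfB.
move=> n X Y XA YA XY.
(* Apply [val] entrywise to reach matrices over the ambient operator algebra; its injectivity brings
   the conclusion back. *)
have := @A0_stably_finite R n (map_mx val X) (map_mx val Y).
rewrite -!map_mxM XY map_mx1 => /(_ _ _ erefl) h.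
apply/matrixP => i j; apply: val_inj.
have /matrixP/(_ i j) : map_mx val (Y *m X) = 1%:M.
  by apply: h => a b; rewrite mxE; [exact: XA|exact: YA].
by rewrite !mxE => ->; rewrite rmorph_nat.
Qed.
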